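(* Let $A$ be the space of functions $u:\overline S\to\mathbb R$ vanishing on $\partial S$, with norm $\|u\|=\left(\sum_{x\in\overline S}|u(x)|^2\right)^{1/2}$, and let $p:\overline S\to[2,+\infty)$. Then for every $u\in A$: (a.1) for every $m\ge 1$, $\displaystyle\sum_{x\in S}|u(x)|^m\le |S|\,\|u\|^m$; (a.2) for every $m\ge 2$, $\displaystyle\sum_{x,y\in\overline S}|u(y)-u(x)|^m\le 2^m|\overline S||S|\,\|u\|^m$; (a.3) for every $m\ge 2$, $\displaystyle\sum_{x\in S}|u(x)|^m\ge 2^{-\frac m2}|\partial S|^{\frac m2}|\overline S|^{1-m}\|u\|^m$; (a.4) $\displaystyle\sum_{x\in S}|u(x)|^{p(x)}\ge 2^{-\frac{p^-}{2}}|\partial S|^{\frac{p^-}{2}}|\overline S|^{1-p^-}\|u\|^{p^-}-|S|$; (a.5) $\displaystyle\sum_{x,y\in\overline S}|u(y)-u(x)|^{p(x)}\omega(x,y)\le \overline\omega^+2^{\overline p^+}|\overline S||S|\,\|u\|^{\overline p^+}+\overline\omega^+|\overline S|^2$; (a.6) $\displaystyle\sum_{x\in S}|u(x)|^{p(x)}\le |S|\,\|u\|^{p^+}+|S|$; (a.7) $\displaystyle\max_{x\in S}|u(x)|\le|\overline S|^{\frac12}\|u\|$.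
   Context: Let $\overline S=(S\cup\partial S,V)$ be a simple, connected, undirected, weighted graph whose vertex set is the union of two finite, disjoint, nonempty sets $S$ (interior) and $\partial S$ (boundary), and whose edge set is $V$, a set of unordered pairs of distinct vertices. The symbol $\overline S$ also denotes the vertex set $S\cup\partial S$; $|\cdot|$ of a set is its cardinality. The weight is a function $\omega:\overline S\times\overline S\to[0,+\infty)$ with $\omega(x,y)=\omega(y,x)$ if $\{x,y\}\in V$, and $\omega(x,y)=0$ if and only if $\{x,y\}\notin V$. Notation: $p^-=\min_{x\in S}p(x)$, $p^+=\max_{x\in S}p(x)$, $\overline p^+=\max_{x\in\overline S}p(x)$, $\overline\omega^+=\max_{(x,y)\in\overline S\times\overline S}\omega(x,y)$. The exponents $m$ are real numbers. *)

(* Defs.v *)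
From mathcomp Require Import all_boot all_order all_algebra.
From mathcomp Require Import reals exp.

Set Implicit Arguments.
Unset Strict Implicit.
Unset Printing Implicit Defensive.

Import Order.TTheory GRing.Theory Num.Theory.
Local Open Scope ring_scope.

(* The vertex set is the whole type T, partitioned into interior and boundary.
   The edges are two-element sets, so [set x; x] is never an edge and
   weight x x = 0. *)
Record wgraph (R : realType) (T : finType) := WGraph {
  interior : {set T};
  boundary : {set T};
  edges : {set {set T}};
  weight : T -> T -> R;
  interior_neq0 : interior != set0;
  boundary_neq0 : boundary != set0;
  interior_boundary_disjoint : [disjoint interior & boundary];
  interior_boundary_cover : interior :|: boundary = [set: T];
  edges_card2 : forall e, e \in edges -> #|e| = 2%N;
  wgraph_connected :
    forall x y, connect (fun a b => [set a; b] \in edges) x y;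
  weight_ge0 : forall x y, 0 <= weight x y;
  weight_sym : forall x y, [set x; y] \in edges -> weight x y = weight y x;
  weight_eq0 : forall x y, weight x y = 0 <-> [set x; y] \notin edges
}.

(* Minimum and maximum over a finite set; the value 0 on the empty set is a
   junk value. *)
Definition min_on (R : realType) (T : finType) (D : {set T}) (f : T -> R) : R :=
  if [pick x in D] is Some x0 then f [arg min_(x < x0 in D) f x]%O else 0.

Definition max_on (R : realType) (T : finType) (D : {set T}) (f : T -> R) : R :=
  if [pick x in D] is Some x0 then f [arg max_(x > x0 in D) f x]%O else 0.

Lemma min_onP (R : realType) (T : finType) (D : {set T}) (f : T -> R) :
  D != set0 ->
  (exists2 x, x \in D & min_on D f = f x) /\
  (forall x, x \in D -> min_on D f <= f x).
Proof.
move=> /set0Pn[y yD]; rewrite /min_on.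
case: pickP => [x0 x0D|/(_ y)]; last by rewrite yD.
by case: arg_minP => // i iD ile; split; [exists i|move=> x /ile].
Qed.

Lemma max_onP (R : realType) (T : finType) (D : {set T}) (f : T -> R) :
  D != set0 ->
  (exists2 x, x \in D & max_on D f = f x) /\
  (forall x, x \in D -> f x <= max_on D f).
Proof.
move=> /set0Pn[y yD]; rewrite /max_on.
case: pickP => [x0 x0D|/(_ y)]; last by rewrite yD.
by case: arg_maxP => // i iD ile; split; [exists i|move=> x /ile].
Qed.

Definition weight_max (R : realType) (T : finType) (G : wgraph R T) : R :=
  max_on [set: T * T] (fun xy => weight G xy.1 xy.2).

Definition spaceA (R : realType) (T : finType) (G : wgraph R T) (u : T -> R) :
    Prop :=
  forall x, x \in boundary G -> u x = 0.

Definition normA (R : realType) (T : finType) (u : T -> R) : R :=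
  Num.sqrt (\sum_(x : T) `|u x| ^+ 2).

(* Main.v *)
(** The supremum of [|u|] is at most [normA u], which gives the upper bounds
    termwise; for differences one adds
    [(a + b)^m <= 2^(m-1) (a^m + b^m)].  The lower bound is the power mean
    inequality for [|u|^2] with exponent [m/2], giving the sharper constant
    [#|S|^(1 - m/2)].  A variable exponent is reduced to a constant one by
    [a^r <= a^s + 1] for [0 < r <= s]. *)

Require Import Defs.
From mathcomp Require Import all_boot all_order all_algebra.
From mathcomp Require Import reals exp.
From mathcomp Require Import ring lra.

Import Order.TTheory GRing.Theory Num.Theory.
Local Open Scope ring_scope.

Section PowerInequalities.
Context {R : realType}.
Implicit Types a b r s t c : R.

(* The graph of [x^r] lies above its tangent at [c]; this is Young's inequality
   for [t] and [c^(r-1)]. *)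
Lemma powR_ge_tangent r t c : 1 <= r -> 0 <= t -> 0 <= c ->
  r * t * c `^ (r - 1) <= t `^ r + (r - 1) * c `^ r.
Proof.
(* The conjugate exponent [r / (r - 1)] requires [r != 1]; at [r = 1] both sides equal [t]. *)
move=> r1 t0 c0; have [->|rN1] := eqVneq r 1.
  by rewrite subrr powRr0 powRr1// mul0r; lra.
have {rN1} rgt1 : 1 < r by rewrite lt_neqAle eq_sym rN1.
have r0 : 0 < r by lra.
have rB0 : 0 < r - 1 by lra.
have := @conjugate_powR R t (c `^ (r - 1)) r (r / (r - 1)) t0 (powR_ge0 _ _) r0.
rewrite divr_gt0// => /(_ isT).
have -> : r^-1 + (r / (r - 1))^-1 = 1 by field; rewrite !gt_eqF.
move=> /(_ erefl); rewrite -powRrM.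
have -> : (r - 1) * (r / (r - 1)) = r by field; rewrite gt_eqF.
move=> h; rewrite -mulrA; apply: (le_trans (ler_wpM2l (ltW r0) h)).
rewrite le_eqVlt; apply/orP; left; apply/eqP.
by field; rewrite !gt_eqF.
Qed.

(** Sum the tangent inequality for the values [f i], with the tangent taken at their mean [c]. The
    linear terms add up to [r * n * c^r], which leaves [n * c^r <= \sum f i ^ r]; multiplying by
    [n^(r-1)] turns the left side into [(n * c)^r]. *)
Lemma power_mean (I : finType) (D : {set I}) (f : I -> R) r :
  1 <= r -> (forall i, 0 <= f i) ->
  (\sum_(i in D) f i) `^ r <= #|D|%:R `^ (r - 1) * \sum_(i in D) f i `^ r.
Proof.
move=> r1 f0; have r0 : 0 < r by lra.
have [->|/set0Pn[i0 i0D]] := eqVneq D set0.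
  by rewrite !big_set0 powR0 ?gt_eqF// mulr0.
have n0 : 0 < #|D|%:R :> R by rewrite ltr0n; apply/card_gt0P; exists i0.
set n := #|D|%:R in n0 *; set s := \sum_(i in D) f i.
have s0 : 0 <= s by rewrite sumr_ge0.
pose c := s / n; have c0 : 0 <= c by rewrite divr_ge0// ltW.
have sE : s = n * c by rewrite /c; field; rewrite gt_eqF.
have -> : s `^ r = n `^ (r - 1) * (n * c `^ r).
  by rewrite sE powRM// ?ltW// -(mulr_powRB1 (ltW n0) r0); ring.
rewrite ler_wpM2l ?powR_ge0//.
have : \sum_(i in D) (r * f i * c `^ (r - 1)) <=
       \sum_(i in D) (f i `^ r + (r - 1) * c `^ r).
  by apply: ler_sum => i _; apply: powR_ge_tangent.
rewrite big_split/= sumr_const -mulr_natr -mulr_suml -mulr_sumr -/n -/s sE.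
have -> : r * (n * c) * c `^ (r - 1) = r * n * c `^ r.
  by rewrite -(mulr_powRB1 c0 r0); ring.
lra.
Qed.

(** This is [power_mean] on the two points of [bool]. *)
Lemma powRD_le a b r : 1 <= r -> 0 <= a -> 0 <= b ->
  (a + b) `^ r <= 2 `^ (r - 1) * (a `^ r + b `^ r).
Proof.
move=> r1 a0 b0.
have sumE (g : bool -> R) : \sum_(i in [set: bool]) g i = g true + g false.
  by rewrite -big_bool; apply: eq_bigl => i; rewrite inE.
have f0 (i : bool) : 0 <= (if i then a else b) by case: i.
have := @power_mean bool [set: bool] (fun i => if i then a else b) r r1 f0.
by rewrite cardsT card_bool !sumE.
Qed.

(** For [a >= 1] the power grows with the exponent; for [a < 1] it is at most 1. Summed, the 1
    yields the additive terms in the estimates with variable exponent. *)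
Lemma powR_le_powRD1 a r s : 0 <= a -> 0 < r -> r <= s -> a `^ r <= a `^ s + 1.
Proof.
move=> a0 r0 rs; have [a1|/ltW a1] := leP 1 a.
  by rewrite (le_trans (ler_powR a1 rs))// lerDl.
apply: le_trans (_ : 1 <= _); last by rewrite lerDr powR_ge0.
by rewrite -[leRHS](congr1 (fun h => h r) (@powR1 R)) ge0_ler_powR// ?nnegrE// ltW.
Qed.

End PowerInequalities.

Section NormEstimates.
Context {R : realType} {T : finType}.
Implicit Types (u : T -> R) (D : {set T}) (m : R).

Lemma normA_ge0 u : 0 <= normA u.
Proof. exact: sqrtr_ge0. Qed.

Lemma abs_le_normA u x : `|u x| <= normA u.
Proof.
rewrite -(@ler_pXn2r _ 2)// ?nnegrE ?normA_ge0// sqr_sqrtr; last first.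
  by rewrite sumr_ge0// => i _; rewrite exprn_ge0.
by rewrite (bigD1 x)//= lerDl sumr_ge0// => i _; rewrite exprn_ge0.
Qed.

Lemma sum_powR_le_normA u D m : 0 <= m ->
  \sum_(x in D) `|u x| `^ m <= #|D|%:R * normA u `^ m.
Proof.
move=> m0; rewrite mulr_natl -sumr_const; apply: ler_sum => x _.
by rewrite ge0_ler_powR// ?nnegrE ?normA_ge0// abs_le_normA.
Qed.

Lemma sum_powR_diff_le u m : 1 <= m ->
  \sum_(x : T) \sum_(y : T) `|u y - u x| `^ m
    <= 2 `^ m * #|T|%:R * \sum_(x : T) `|u x| `^ m.
Proof.
move=> m1; have m0 : 0 < m by lra.
have le_term x y : `|u y - u x| `^ m <=
    2 `^ (m - 1) * (`|u y| `^ m + `|u x| `^ m).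
  apply: le_trans (powRD_le _ _ _ m1 (normr_ge0 _) (normr_ge0 _)).
  by rewrite ge0_ler_powR ?nnegrE ?addr_ge0 ?ler_normB// ltW.
apply: (le_trans (ler_sum _ (fun x _ => ler_sum _ (fun y _ => le_term x y)))).
under eq_bigr do rewrite -mulr_sumr big_split/= sumr_const.
(* Each of the two summands contributes [#|T|] times the sum of [|u|^m], and [2 * 2^(m-1) = 2^m]. *)
rewrite -mulr_sumr big_split/= sumr_const sumrMnl -(mulr_powRB1 (ler0n R 2) m0).
by rewrite -[_ *+ #|T|]mulr_natr; lra.
Qed.

Lemma sum_powR_ge_normA u D m : 2 <= m ->
  (forall x, x \notin D -> u x = 0) ->
  normA u `^ m <= #|D|%:R `^ (m / 2 - 1) * \sum_(x in D) `|u x| `^ m.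
Proof.
move=> m2 u0.
have powR_half a : 0 <= a -> (a ^+ 2) `^ (m / 2) = a `^ m.
  by move=> a0; rewrite -powR_mulrn// -powRrM; congr (_ `^ _); field.
rewrite -powR_half ?normA_ge0// sqr_sqrtr; last first.
  by rewrite sumr_ge0// => i _; rewrite exprn_ge0.
(* Dropping the zero terms outside [D] before taking power means is what puts [#|D|] rather than
   [#|T|] in the constant. *)
rewrite (bigID (mem D))/= [X in _ + X]big1 ?addr0; last first.
  by move=> x /u0->; rewrite normr0 expr0n.
under [in leRHS]eq_bigr do rewrite -powR_half//.
by apply: power_mean => [|x]; [lra|rewrite exprn_ge0].
Qed.

End NormEstimates.

Theorem lemma5 (R : realType) (T : finType) (G : wgraph R T) (p : T -> R)
    (hp : forall x : T, 2 <= p x) (u : T -> R) (hu : spaceA G u) :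
  let S := interior G in
  let bS := boundary G in
  let pm := min_on S p in
  let pp := max_on S p in
  let ppbar := max_on [set: T] p in
  let wp := weight_max G in
  (forall m : R, 1 <= m ->
    \sum_(x in S) `|u x| `^ m <= #|S|%:R * normA u `^ m)
  /\ (forall m : R, 2 <= m ->
    \sum_(x : T) \sum_(y : T) `|u y - u x| `^ m
      <= 2 `^ m * #|T|%:R * #|S|%:R * normA u `^ m)
  /\ (forall m : R, 2 <= m ->
    2 `^ (- (m / 2)) * #|bS|%:R `^ (m / 2) * #|T|%:R `^ (1 - m) * normA u `^ m
      <= \sum_(x in S) `|u x| `^ m)
  /\ 2 `^ (- (pm / 2)) * #|bS|%:R `^ (pm / 2) * #|T|%:R `^ (1 - pm)
        * normA u `^ pm - #|S|%:R
      <= \sum_(x in S) `|u x| `^ p x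
  /\ \sum_(x : T) \sum_(y : T) `|u y - u x| `^ p x * weight G x y
      <= wp * 2 `^ ppbar * #|T|%:R * #|S|%:R * normA u `^ ppbar
         + wp * #|T|%:R ^+ 2
  /\ \sum_(x in S) `|u x| `^ p x <= #|S|%:R * normA u `^ pp + #|S|%:R
  /\ max_on S (fun x => `|u x|) <= Num.sqrt #|T|%:R * normA u.
Proof.
move=> S bS pm pp ppbar wp.
have S0 : S != set0 := interior_neq0 G.
have SP x : x \notin S -> u x = 0.
  move=> xS; apply: hu; have := in_setT x.
  by rewrite -(interior_boundary_cover G) inE (negbTE xS).
have T0 : [set: T] != set0.
  by have /set0Pn[x _] := S0; apply/set0Pn; exists x; rewrite inE.
have [[x1 _ pmE] pm_le] := min_onP p S0.
have [[x2 _ ppE] le_pp] := max_onP p S0.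
have [[x3 _ ppbarE] le_ppbar] := max_onP p T0.
have pm2 : 2 <= pm by rewrite /pm pmE.
have pp2 : 2 <= pp by rewrite /pp ppE.
have ppbar2 : 2 <= ppbar by rewrite /ppbar ppbarE.
have n1 : 1 <= #|T|%:R :> R.
  by rewrite ler1n; have /set0Pn[x _] := S0; apply/card_gt0P; exists x.
have a1 (m : R) : 1 <= m ->
    \sum_(x in S) `|u x| `^ m <= #|S|%:R * normA u `^ m.
  by move=> m1; apply: sum_powR_le_normA; lra.
have a2 (m : R) : 2 <= m -> \sum_(x : T) \sum_(y : T) `|u y - u x| `^ m
      <= 2 `^ m * #|T|%:R * #|S|%:R * normA u `^ m.
  move=> m2; have m1 : 1 <= m by lra.
  apply: (le_trans (sum_powR_diff_le u m m1)).
  rewrite -mulrA -[leRHS]mulrA -[leRHS]mulrA ler_wpM2l ?powR_ge0// ler_wpM2l//.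
  (* The sum over all vertices reduces to [S], because [u] vanishes elsewhere and [0^m = 0] for
     [m != 0]. *)
  rewrite (bigID (mem S))/= [X in _ + X]big1 ?addr0; first exact: a1.
  by move=> x /SP->; rewrite normr0 powR0// gt_eqF//; lra.
have a3 (m : R) : 2 <= m ->
    2 `^ (- (m / 2)) * #|bS|%:R `^ (m / 2) * #|T|%:R `^ (1 - m) * normA u `^ m
      <= \sum_(x in S) `|u x| `^ m.
  move=> m2; set Q := \sum_(x in S) _.
  have Q0 : 0 <= Q by apply: sumr_ge0 => x _; apply: powR_ge0.
  have leQ : normA u `^ m <= #|T|%:R `^ (m / 2 - 1) * Q.
    apply: (le_trans (sum_powR_ge_normA u S m m2 SP)).
    rewrite ler_wpM2r// ge0_ler_powR ?nnegrE ?ler_nat ?max_card//; lra.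
  have two_le1 : 2 `^ (- (m / 2)) <= 1 :> R.
    by rewrite -[leRHS](powRr0 2) ler_powR; lra.
  have b_le : #|bS|%:R `^ (m / 2) <= #|T|%:R `^ (m / 2) :> R.
    by rewrite ge0_ler_powR ?nnegrE ?ler_nat ?max_card//; lra.
  (* This crude bound suffices: with the factors [#|T|^(1-m)] and, from [leQ], [#|T|^(m/2-1)], the
     exponents of [#|T|] add up to 0. *)
  have c_le : 2 `^ (- (m / 2)) * #|bS|%:R `^ (m / 2) <= #|T|%:R `^ (m / 2) :> R.
    by rewrite -[leRHS]mul1r ler_pM ?powR_ge0.
  apply: (le_trans (ler_pM _ _ (ler_wpM2r (powR_ge0 _ _) c_le) leQ));
    rewrite ?mulr_ge0 ?powR_ge0//.
  have nN0 : #|T|%:R != 0 :> R by rewrite gt_eqF//; lra.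
  rewrite mulrA -!powRD ?nN0 ?implybT//.
  have -> : m / 2 + (1 - m) + (m / 2 - 1) = 0 by field.
  by rewrite powRr0 mul1r.
split; [exact: a1|split; [exact: a2|split; [exact: a3|]]].
split; [|split; [|split]].
(* [a3] at the constant exponent [pm]; [#|S|] is spread over [S] as a sum of ones to compare
   termwise. *)
- rewrite lerBlDr (le_trans (a3 _ pm2))// -[X in _ + X]sumr_const -big_split/=.
  apply: ler_sum => x xS; apply: powR_le_powRD1; rewrite ?pm_le//; lra.
- have w_le x y : weight G x y <= wp.
    have TT0 : [set: T * T] != set0.
      by have /set0Pn[z _] := S0; apply/set0Pn; exists (z, z); rewrite inE.
    have [_] := max_onP (fun xy => weight G xy.1 xy.2) TT0.
    by move=> /(_ (x, y)); rewrite inE; apply.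
  have wp0 : 0 <= wp.
    by have /set0Pn[z _] := S0; rewrite (le_trans (weight_ge0 G z z)).
  (* With the weight replaced by [wp] and the exponent by [ppbar], the bound is uniform in the pair;
     the powers fall under [a2] and the ones sum to [#|T|^2]. *)
  have le_term x y : `|u y - u x| `^ p x * weight G x y <=
      wp * (`|u y - u x| `^ ppbar + 1).
    rewrite mulrC ler_pM ?powR_ge0 ?weight_ge0//.
    by apply: powR_le_powRD1; rewrite ?le_ppbar ?inE// (lt_le_trans _ (hp x)).
  apply: (le_trans (ler_sum _ (fun x _ => ler_sum _ (fun y _ => le_term x y)))).
  under eq_bigr do rewrite -mulr_sumr big_split/= sumr_const.
  rewrite -mulr_sumr big_split/= sumr_const -!mulrA -mulrDr ler_wpM2l//.
  by rewrite lerD// ?mulrA ?a2// -mulrnA expr2 -natrM.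
- apply: le_trans (lerD (a1 pp _) (lexx _)); last lra.
  rewrite -[X in _ + X]sumr_const -big_split/=; apply: ler_sum => x xS.
  by apply: powR_le_powRD1; rewrite ?le_pp// (lt_le_trans _ (hp x)).
- have [[x _ ->] _] := max_onP (fun x => `|u x|) S0.
  (* The factor [Num.sqrt #|T|] is at least 1, so the bound by [normA u] alone is enough. *)
  rewrite (le_trans (abs_le_normA u x))// ler_peMl ?normA_ge0//.
  by rewrite -[leLHS]sqrtr1 ler_wsqrtr.
Qed.
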